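(* Let $k\ge 0$ be an integer and let $m_1\ge m_2$ be integers. If the level $m_1+m_2$ of the complex algebra $A=\mathrm{IDD}(K^k_\infty,m_1,m_2)$ satisfies $m_1+m_2<k$, then $A$ is pro-nilpotent.
   Context: For an integer $m$ and an integer $i\ge 0$ put $c_m(i)=\frac{i!}{(i-m)!}$ if $i\ge m$ and $c_m(i)=0$ if $i<m$ (so $T^m(x^i)=c_m(i)x^{i-m}$, where $T^m$ is the $m$-th derivative for $m>0$, the identity for $m=0$, and the $|m|$-fold iterate of $\int x^i=\frac{1}{i+1}x^{i+1}$ for $m<0$). The algebra $\mathrm{IDD}(K^k_\infty,m_1,m_2)$ is the complex algebra with basis $e_k,e_{k+1},e_{k+2},\ldots$ and bilinear multiplication $e_i\diamond e_j=c_{m_1}(i)\,c_{m_2}(j)\,e_{i+j-m_1-m_2}$ if $i+j-m_1-m_2\ge k$, and $e_i\diamond e_j=0$ otherwise. Its level is $m_1+m_2$. An infinite-dimensional algebra $A$ is pro-nilpotent if $\bigcap_{t\ge1}A^t=\{0\}$, where $A^1=A$ and $A^t=\sum_{i+j=t}A^iA^j$ ($i,j\ge 1$). *)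

(* Defs.v *)
From HB Require Import structures.
From mathcomp Require Import all_boot all_order all_algebra.
From mathcomp Require Import classical_sets reals complex.

Set Implicit Arguments.
Unset Strict Implicit.
Unset Printing Implicit Defensive.

Import Order.TTheory GRing.Theory Num.Theory.
Local Open Scope ring_scope.
Local Open Scope classical_set_scope.

(* An algebra, associative or not, is a module A with a bilinear product. *)
Section Algebra.
Variables (K : numFieldType) (A : lmodType K).

Definition lin_span (S : set A) : set A :=
  [set x | exists (n : nat) (a : 'I_n -> K) (v : 'I_n -> A),
     (forall l, S (v l)) /\ x = \sum_(l < n) a l *: v l].

Definition infinite_dim : Prop :=
  ~ exists (n : nat) (v : 'I_n -> A), lin_span (range v) = setT.

Variable mul : {bilinear A -> A -> A}.

Definition sub_mul (U V : set A) : set A :=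
  lin_span [set x | exists u v, [/\ U u, V v & x = mul u v]].

(* The sum of the subspaces A^i A^j, i + j = t and i, j >= 1; the index l of a
   summand stands for (i, j) = (l + 1, t - (l + 1)). *)
Definition sum_mul (P : nat -> set A) (t : nat) : set A :=
  [set x | exists w : 'I_t.-1 -> A,
     (forall l : 'I_t.-1, sub_mul (P l.+1) (P (t - l.+1)%N) (w l)) /\
     x = \sum_(l < t.-1) w l].

(* The course-of-values recursion defining A^t is run with fuel n; any n >= t
   gives the same result, see alg_powS. *)
Fixpoint alg_pow_fuel (n t : nat) : set A :=
  if n is n'.+1 then
    if (t <= 1)%N then setT else sum_mul (alg_pow_fuel n') t
  else setT.

Definition alg_pow (t : nat) : set A := alg_pow_fuel t t.

Lemma eq_sum_mul (P Q : nat -> set A) (t : nat) :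
  (forall i, (0 < i < t)%N -> P i = Q i) -> sum_mul P t = sum_mul Q t.
Proof.
move=> PQ; rewrite /sum_mul; apply/seteqP.
have lt_lt (l : 'I_t.-1) : (l.+1 < t)%N by have := ltn_ord l; rewrite ltn_predRL.
have lt_tl (l : 'I_t.-1) : (0 < t - l.+1 < t)%N.
  by rewrite subn_gt0 lt_lt ltn_subrL (leq_trans _ (lt_lt l)).
by split=> x [w [wP ->]]; exists w; split=> // l; have := wP l;
  rewrite !PQ ?lt_tl ?lt_lt.
Qed.

Lemma alg_pow_fuelE (n t : nat) : (t <= n)%N -> alg_pow_fuel n t = alg_pow t.
Proof.
suff H m : forall n1 n2 s, (s <= m)%N -> (s <= n1)%N -> (s <= n2)%N ->
    alg_pow_fuel n1 s = alg_pow_fuel n2 s by move=> le_tn; apply: (H t).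
elim: m => [|m IHm] n1 n2 s.
  by rewrite leqn0 => /eqP-> _ _; case: n1 n2 => [|n1] [|n2].
case: s => [|s]; first by case: n1 n2 => [|n1] [|n2].
case: n1 n2 => [|n1] [|n2] //= le_sm le_s1 le_s2; case: ifP => // _; apply: eq_sum_mul => i.
case/andP=> _ lt_is; apply: IHm; rewrite -ltnS; exact: leq_trans lt_is _.
Qed.

Lemma alg_pow1 : alg_pow 1 = setT.
Proof. by []. Qed.

Lemma alg_powS (t : nat) : (1 < t)%N -> alg_pow t = sum_mul alg_pow t.
Proof.
case: t => // t lt1t; rewrite {1}/alg_pow /= leqNgt lt1t /=.
by apply: eq_sum_mul => i /andP[_ lt_it]; apply: alg_pow_fuelE.
Qed.

Definition pro_nilpotent : Prop :=
  infinite_dim /\ \bigcap_(t in [set t | (1 <= t)%N]) alg_pow t = [set 0].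

End Algebra.

(* K^k_oo is the span of e_n = 'X^n for n >= k, inside the polynomials. *)
Section IDD.
Variables (K : numFieldType) (k : nat).

Definition vanishes_below : {pred {poly K}} :=
  fun p => [forall i : 'I_k, p`_i == 0].

Lemma vanishes_below_submod_closed : submod_closed vanishes_below.
Proof.
split=> [|a p q /forallP p0 /forallP q0]; apply/forallP => i.
  by rewrite coef0.
by rewrite coefD coefZ (eqP (p0 i)) (eqP (q0 i)) mulr0 addr0.
Qed.

HB.instance Definition _ :=
  GRing.isSubmodClosed.Build K {poly K} vanishes_below
    vanishes_below_submod_closed.

Record Kinf := MkKinf { Kinf_poly : {poly K};
                        Kinf_polyP : Kinf_poly \in vanishes_below }.

HB.instance Definition _ := [isSub for Kinf_poly].
HB.instance Definition _ := [Choice of Kinf by <:].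
HB.instance Definition _ := [SubChoice_isSubLmodule of Kinf by <:].

(* e_n; the junk value for n < k is 0. *)
Definition basis_e (n : nat) : Kinf := insubd (0 : Kinf) 'X^n.

Lemma basis_eE (n : nat) : (k <= n)%N -> Kinf_poly (basis_e n) = 'X^n.
Proof.
move=> le_kn; apply: insubdK; apply/forallP => i.
by rewrite coefXn ltn_eqF // (leq_trans (ltn_ord i)).
Qed.

(* T^m 'X^i = coef_c m i *: 'X^(i - m), T^m being the m-th derivative, or the
   |m|-fold iterate of 'X^i |-> 'X^(i+1) / (i+1) when m < 0. *)
Definition coef_c (m : int) (i : nat) : K :=
  if m <= i%:Z then (i`!)%:R / ((`|i%:Z - m|%N)`!)%:R else 0.

Variables m1 m2 : int.

(* e_i <> e_j; IDD_basis checks that idd_mul takes these values. *)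
Definition idd_table (i j : nat) : Kinf :=
  let d := i%:Z + j%:Z - m1 - m2 in
  if k%:Z <= d then (coef_c m1 i * coef_c m2 j) *: basis_e `|d|%N else 0.

Definition idd_mul (p q : Kinf) : Kinf :=
  \sum_(i < size (Kinf_poly p)) \sum_(j < size (Kinf_poly q))
    ((Kinf_poly p)`_i * (Kinf_poly q)`_j) *: idd_table i j.

Lemma idd_mul_widen (M N : nat) (p q : Kinf) :
  (size (Kinf_poly p) <= M)%N -> (size (Kinf_poly q) <= N)%N ->
  idd_mul p q = \sum_(i < M) \sum_(j < N)
    ((Kinf_poly p)`_i * (Kinf_poly q)`_j) *: idd_table i j.
Proof.
move=> leM leN; rewrite /idd_mul.
pose F i j := ((Kinf_poly p)`_i * (Kinf_poly q)`_j) *: idd_table i j.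
transitivity (\sum_(i < size (Kinf_poly p)) \sum_(j < N) F i j).
  apply: eq_bigr => i _; rewrite (big_ord_widen N (F i)) // big_mkcond /=.
  apply: eq_bigr => j _; case: ltnP => // le_j.
  by rewrite /F [(Kinf_poly q)`_j]nth_default // mulr0 scale0r.
rewrite (big_ord_widen M (fun i => \sum_(j < N) F i j)) // big_mkcond /=.
apply: eq_bigr => i _; case: ltnP => // le_i.
by rewrite big1 // => j _; rewrite [(Kinf_poly p)`_i]nth_default // mul0r scale0r.
Qed.

Lemma idd_mul_bilinear :
  bilinear_for (GRing.Scale.Law.clone _ _ *:%R _)
    (GRing.Scale.Law.clone _ _ *:%R _) (idd_mul : Kinf -> Kinf -> Kinf).
Proof.
split=> [q|p] a.
- move=> p p'; set M := maxn (size (Kinf_poly p))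
    (maxn (size (Kinf_poly p')) (size (Kinf_poly (a *: p + p')))).
  have leN := leqnn (size (Kinf_poly q)).
  rewrite /= !(@idd_mul_widen M _ _ q _ leN) ?leq_max ?leqnn ?orbT //.
  rewrite scaler_sumr -big_split; apply: eq_bigr => i _.
  rewrite scaler_sumr -big_split; apply: eq_bigr => j _ /=.
  by rewrite coefD coefZ mulrDl scalerDl scalerA mulrA.
- move=> q q'; set N := maxn (size (Kinf_poly q))
    (maxn (size (Kinf_poly q')) (size (Kinf_poly (a *: q + q')))).
  have leM := leqnn (size (Kinf_poly p)).
  rewrite /= !(@idd_mul_widen _ N p _ leM) ?leq_max ?leqnn ?orbT //.
  rewrite scaler_sumr -big_split; apply: eq_bigr => i _.
  rewrite scaler_sumr -big_split; apply: eq_bigr => j _ /=.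
  by rewrite coefD coefZ mulrDr scalerDl scalerA mulrCA.
Qed.

HB.instance Definition _ :=
  bilinear_isBilinear.Build K Kinf Kinf Kinf _ _ idd_mul idd_mul_bilinear.

Definition IDD : {bilinear Kinf -> Kinf -> Kinf} := idd_mul.

Lemma basis_e_span (p : Kinf) :
  p = \sum_(i < size (Kinf_poly p)) (Kinf_poly p)`_i *: basis_e i.
Proof.
apply: val_inj; rewrite raddf_sum /= -[LHS]coefK poly_def.
apply: eq_bigr => i _; have [/basis_eE ek|lt_ik] := leqP k i.
  by rewrite ek.
have /forallP/(_ (Ordinal lt_ik))/eqP /= -> := Kinf_polyP p.
by rewrite !scale0r.
Qed.

Lemma basis_e_free (n : nat) (a : 'I_n -> K) :
  \sum_(l < n) a l *: basis_e (k + l) = 0 -> forall l, a l = 0.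
Proof.
move=> /(congr1 val); rewrite raddf_sum /= => e0 l.
have := congr1 (fun p : {poly K} => p`_(k + l)) e0; rewrite coef0 coef_sum.
rewrite (bigD1 l) //= big1 ?addr0 => [|i ne_il]; rewrite basis_eE ?leq_addr //.
  by rewrite coefZ coefXn eqxx mulr1.
by rewrite coefZ coefXn eqn_add2l eq_sym (negPf (ne_il : (i : nat) != l)) mulr0.
Qed.

Lemma IDD_basis (i j : nat) : (k <= i)%N -> (k <= j)%N ->
  IDD (basis_e i) (basis_e j) = idd_table i j.
Proof.
move=> ki kj; rewrite /IDD /= /idd_mul !basis_eE // !size_polyXn.
rewrite big_ord_recr /= [X in X + _]big1 ?add0r => [|l _].
  rewrite big_ord_recr /= [X in X + _]big1 ?add0r => [|l _].
    by rewrite !coefXn !eqxx mulr1 scale1r.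
  by rewrite !coefXn (ltn_eqF (ltn_ord l)) mulr0 scale0r.
rewrite big1 // => l' _.
by rewrite coefXn (ltn_eqF (ltn_ord l)) mul0r scale0r.
Qed.

End IDD.

(* Main.v *)
Require Import Defs.
From mathcomp Require Import all_boot all_order all_algebra.
From mathcomp Require Import classical_sets reals complex.
From mathcomp Require Import zify.

Import Order.TTheory GRing.Theory Num.Theory.
Local Open Scope ring_scope.

(** The product is homogeneous for a shifted degree.  Give [e_i] the weight
    [i - (m1 + m2)]: a nonzero product of [e_i] and [e_j] is a multiple of
    [e_(i + j - m1 - m2)], whose weight is the sum of the weights of [e_i] and
    [e_j].  When the level is less than [k], each basis vector has weight at
    least 1, so a product of [t] factors, in any bracketing, has only terms of
    weight at least [t] ([alg_pow_sub_weight_ge]).  A given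
    ['X^n] has a fixed weight, so its coefficient is 0 in every element of
    [A^t] once [t] is large, and the intersection of the powers is [0].

    Infinite dimension holds because the polynomials in the span of finitely
    many have bounded degree ([Kinf_infinite_dim]). *)

Section Filtration.
Variables (K : numFieldType) (A : lmodType K) (mul : {bilinear A -> A -> A}).

Lemma lin_span_sub (S F : set A) :
    F 0 -> (forall a u v, F u -> F v -> F (a *: u + v)) ->
  (S `<=` F -> lin_span S `<=` F)%classic.
Proof.
move=> F0 Flin SF x [n [a [v [Sv ->]]]]; elim/big_ind: _ => // [u w Fu Fw|l _].
  by rewrite -[u]scale1r; apply: Flin.
by rewrite -[_ *: _]addr0; apply: Flin => //; apply: SF.
Qed.

(** By strong induction on [t]: for [t > 1], [A^t] is spanned by products of an
    element of [A^i] and an element of [A^(t-i)] with [0 < i < t]. *)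
Lemma alg_pow_sub_filtration (F : nat -> set A) :
    F 1%N = setT ->
    (forall t, F t 0) ->
    (forall t a u v, F t u -> F t v -> F t (a *: u + v)) ->
    (forall s t u v, F s u -> F t v -> F (s + t)%N (mul u v)) ->
  forall t, (0 < t)%N -> (alg_pow mul t `<=` F t)%classic.
Proof.
move=> F1 F0 Flin Fmul; elim/ltn_ind=> -[|[|t]] // IHt _.
  by rewrite F1 => x _.
rewrite alg_powS // => x [w [Pw ->]].
elim/big_ind: _ => // [u v Fu Fv|l _]; first by rewrite -[u]scale1r; apply: Flin.
apply: (@lin_span_sub _ (F t.+2) _ _ _ _ (Pw l)) => //.
  by move=> a u v; apply: Flin.
move=> _ [u [v [Pu Pv ->]]].
case: l Pu Pv => l /= lt_lt Pu Pv.
have -> : t.+2 = (l.+1 + (t.+2 - l.+1))%N by lia.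
by apply: Fmul; [apply: (IHt l.+1) | apply: (IHt (t.+2 - l.+1)%N)] => //; lia.
Qed.

Lemma alg_pow0 (t : nat) : alg_pow mul t 0.
Proof.
case: t => [|[|t]] //; rewrite alg_powS //; exists (fun=> 0).
split=> [l|]; last by rewrite big1.
by exists 0%N, (fun=> 0), (fun=> 0); split=> [[]|]; rewrite ?big_ord0.
Qed.

End Filtration.

Lemma coef_Kinf_sum (K : numFieldType) (k m n : nat) (F : 'I_m -> Kinf K k) :
  (Kinf_poly (\sum_(i < m) F i))`_n = \sum_(i < m) (Kinf_poly (F i))`_n.
Proof.
by apply: (big_morph (fun p => (Kinf_poly p)`_n)) => [p q|];
  rewrite ?coef0 ?coefD.
Qed.

Lemma Kinf_infinite_dim (K : numFieldType) (k : nat) :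
  infinite_dim (Kinf K k).
Proof.
case=> n [v spanT].
pose N := (k + \sum_(l < n) size (Kinf_poly (v l)))%N.
have : lin_span (range v) (basis_e K k N) by rewrite spanT.
case=> r [a [u [uv /(congr1 (fun p => (Kinf_poly p)`_N))]]].
rewrite basis_eE ?leq_addr // coefXn eqxx.
(* [N] exceeds the degree of every [v l]. *)
rewrite coef_Kinf_sum big1.
  by apply/eqP; rewrite oner_eq0.
move=> l _; rewrite /= coefZ; have [j _ <-] := uv l.
rewrite [X in _ * X]nth_default ?mulr0 // /N (bigD1 j) //=.
by rewrite addnCA leq_addr.
Qed.

Section WeightFiltration.
Variables (K : numFieldType) (k : nat) (m1 m2 : int).

(** The inequality says that the weight [n - (m1 + m2)] of ['X^n] is less
    than [t]. *)
Definition weight_ge (t : nat) : set (Kinf K k) :=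
  fun p => forall n : nat, n%:Z < t%:Z + (m1 + m2) -> (Kinf_poly p)`_n = 0.

Lemma weight_ge_lin (t : nat) (a : K) (p q : Kinf K k) :
  weight_ge t p -> weight_ge t q -> weight_ge t (a *: p + q).
Proof. by move=> tp tq n nt; rewrite coefD coefZ tp // tq // mulr0 addr0. Qed.

Lemma weight_ge0 (t : nat) : weight_ge t 0.
Proof. by move=> n _; rewrite coef0. Qed.

Lemma weight_ge1 : m1 + m2 < k%:Z -> weight_ge 1 = setT.
Proof.
move=> ltmk; apply/seteqP; split=> // p _ n n1.
have lt_nk : (n < k)%N by lia.
by have /forallP/(_ (Ordinal lt_nk))/eqP := Kinf_polyP p.
Qed.

Lemma coef_idd_table_eq0 (i j n : nat) :
  n%:Z != i%:Z + j%:Z - m1 - m2 -> (Kinf_poly (idd_table K k m1 m2 i j))`_n = 0.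
Proof.
move=> nd; rewrite /idd_table; case: ifP => [kd|_]; last by rewrite coef0.
rewrite /= coefZ basis_eE; last by lia.
by rewrite coefXn; case: eqP => [|_]; rewrite ?mulr0 //; lia.
Qed.

(** This is where the shift by [m1 + m2] pays off: it turns the degree
    [i + j - m1 - m2] of a product into a sum of weights. *)
Lemma weight_ge_mul (s t : nat) (p q : Kinf K k) :
  weight_ge s p -> weight_ge t q -> weight_ge (s + t)%N (IDD K k m1 m2 p q).
Proof.
move=> sp tq n n_st; rewrite /IDD /= /idd_mul.
rewrite coef_Kinf_sum big1 // => -[i /= _] _.
rewrite coef_Kinf_sum big1 // => -[j /= _] _.
rewrite /= coefZ.
(* A term of total weight below [s + t] has a factor of too small a weight. *)
have [nd|] := eqVneq n%:Z (i%:Z + j%:Z - m1 - m2); last first.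
  by move=> /coef_idd_table_eq0->; rewrite mulr0.
have [i_s|s_i] := ltP i%:Z (s%:Z + (m1 + m2)).
  by rewrite sp // !mul0r.
by rewrite tq ?mulr0 ?mul0r //; lia.
Qed.

Lemma alg_pow_sub_weight_ge (t : nat) : m1 + m2 < k%:Z -> (0 < t)%N ->
  (alg_pow (IDD K k m1 m2) t `<=` weight_ge t)%classic.
Proof.
move=> ltmk; apply: alg_pow_sub_filtration; first exact: weight_ge1.
- exact: weight_ge0.
- exact: weight_ge_lin.
- exact: weight_ge_mul.
Qed.

Lemma weight_ge_all_eq0 (p : Kinf K k) :
  (forall t : nat, (0 < t)%N -> weight_ge t p) -> p = 0.
Proof.
move=> wp; apply: val_inj; apply/polyP => n; rewrite coef0.
(* [n - (m1 + m2) < n + |m1 + m2| + 1]: the monomial ['X^n] is too light. *)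
have /= := wp (n + absz (m1 + m2)%R).+1 isT n; apply; lia.
Qed.

Lemma IDD_pro_nilpotent :
  m1 + m2 < k%:Z -> pro_nilpotent (IDD K k m1 m2).
Proof.
move=> ltmk; split; first exact: Kinf_infinite_dim.
apply/seteqP; split=> [p Ap|_ -> t _]; last exact: alg_pow0.
apply: weight_ge_all_eq0 => t t0.
exact: (alg_pow_sub_weight_ge t ltmk t0 p (Ap t t0)).
Qed.

End WeightFiltration.

Theorem proposition2p14 (R : realType) (k : nat) (m1 m2 : int)
    (hm : m2 <= m1) (hlevel : m1 + m2 < k%:Z) :
  pro_nilpotent (IDD R[i] k m1 m2).
Proof. exact: IDD_pro_nilpotent. Qed.
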